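(* Let $H$ be a connected hypergraph with a minimal edge cut $F$, and let $H_i$, for $i \in I$, be the connected components of $H \backslash F$. Then $H$ has an Euler family if and only if there exists $J \subseteq I$ with $1 \le |J| \le |F|$ such that (i) $H\left[ \bigcup_{j \in J} V(H_j)\right]$ has a non-empty Euler family, and (ii) $H_i$ has an Euler family for all $i \in I-J$. Likewise, $H$ has a spanning Euler family if and only if there exists $J \subseteq I$ with $1 \le |J| \le |F|$ such that (i) $H\left[ \bigcup_{j \in J} V(H_j)\right]$ has a non-empty spanning Euler family, and (ii) $H_i$ has a spanning Euler family for all $i \in I-J$.
   Context: A hypergraph $H=(V,E)$: non-empty finite vertex set $V$ and finite multiset $E$ of subsets of $V$ (edges). Distinct $u,v$ are adjacent via $e$ if $u,v\in e$. A walk is $v_0e_1v_1\ldots e_kv_k$ with $v_{i-1},v_i$ adjacent via $e_i$; anchors are $v_0,\dots,v_k$; closed if $v_0=v_k$, $k\ge2$; trail if edges are pairwise distinct. Connected components are maximal connected subhypergraphs without empty edges. An Euler family is a set of pairwise edge-disjoint and anchor-disjoint closed trails jointly traversing every edge; it is spanning if every vertex is an anchor of one of its trails. For $V'\subseteq V$, $H[V']$ has vertex set $V'$ and edge multiset $\{\!\{e\cap V': e\in E, e\cap V'\ne\emptyset\}\!\}$. For $F\subseteq E$, $H\backslash F=(V,E-F)$. An edge cut is a set $[S,V-S]_H=\{e\in E: e\cap S\ne\emptyset\ne e\cap(V-S)\}$ for non-empty proper $S\subset V$; minimal if it properly contains no other edge cut.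
   Formalization: The hypergraph H is additionally assumed to have no empty edges; with an empty edge the claim fails (V={a,b}, edges ab, ab, ∅, F the two copies of ab, J=I), since H[V'] drops empty edges while no closed trail traverses one. *)

(* Defs.v *)
From mathcomp Require Import all_boot.

Set Implicit Arguments.
Unset Strict Implicit.
Unset Printing Implicit Defensive.

(* Vertices live in an ambient type V, and edges are labels in E: two labels
   with the same set [inc] are two copies of one edge in the multiset. The
   values of [inc] outside [edges] are irrelevant. *)
Record prehypergraph (V E : finType) := Prehypergraph {
  vertices : {set V};
  edges : {set E};
  inc : E -> {set V}
}.

Section Hypergraphs.
Variables V E : finType.
Implicit Types (H K : prehypergraph V E) (A S : {set V}) (F : {set E}).

Definition is_hypergraph H : Prop :=
  vertices H != set0 /\ {in edges H, forall e, inc H e \subset vertices H}.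

Definition no_empty_edge H : Prop :=
  {in edges H, forall e, inc H e != set0}.

Definition adjacent_via H (e : E) (u v : V) : bool :=
  [&& e \in edges H, u != v, u \in inc H e & v \in inc H e].

(* (v0, [:: (e1, v1); ...; (ek, vk)]) encodes v0 e1 v1 ... ek vk. *)
Definition walk : Type := (V * seq (E * V))%type.

Definition wstart (w : walk) : V := w.1.
Definition wlength (w : walk) : nat := size w.2.
Definition anchors (w : walk) : seq V := w.1 :: [seq x.2 | x <- w.2].
Definition traversed (w : walk) : seq E := [seq x.1 | x <- w.2].
Definition wend (w : walk) : V := last w.1 [seq x.2 | x <- w.2].

Fixpoint walk_from H (u : V) (p : seq (E * V)) : bool :=
  if p is (e, v) :: p' then adjacent_via H e u v && walk_from H v p' else true.

Definition is_walk H (w : walk) : bool :=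
  (wstart w \in vertices H) && walk_from H w.1 w.2.

Definition is_trail H (w : walk) : bool := is_walk H w && uniq (traversed w).

Definition closed_walk (w : walk) : bool :=
  (wstart w == wend w) && (2 <= wlength w).

Definition closed_trail H (w : walk) : bool := is_trail H w && closed_walk w.

Definition hconnected H : Prop :=
  {in vertices H &, forall u v,
    exists w : walk, [/\ is_walk H w, wstart w = u & wend w = v]}.

Definition subhypergraph K H : Prop :=
  [/\ is_hypergraph K,
      vertices K \subset vertices H,
      edges K \subset edges H
    & {in edges K, forall e, inc K e = inc H e :&: vertices K}].

Definition same_hypergraph K H : Prop :=
  [/\ vertices K = vertices H,
      edges K = edges H
    & {in edges K, forall e, inc K e = inc H e}].

Definition connected_component H K : Prop :=
  [/\ subhypergraph K H, hconnected K, no_empty_edge K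
    & forall L, subhypergraph L H -> hconnected L -> no_empty_edge L ->
        subhypergraph K L -> same_hypergraph K L].

Definition connected_components_of H (I : finType)
    (C : I -> prehypergraph V E) : Prop :=
  [/\ forall i, connected_component H (C i),
      forall i j, same_hypergraph (C i) (C j) -> i = j
    & forall K, connected_component H K -> exists i, same_hypergraph K (C i)].

Definition induced H A : prehypergraph V E :=
  Prehypergraph A [set e in edges H | inc H e :&: A != set0]
    (fun e => inc H e :&: A).

Definition delete_edges H F : prehypergraph V E :=
  Prehypergraph (vertices H) (edges H :\: F) (inc H).

Definition cut H S : {set E} :=
  [set e in edges H | (inc H e :&: S != set0)
                   && (inc H e :&: (vertices H :\: S) != set0)].

Definition edge_cut H F : Prop :=
  exists S, [/\ S != set0, S \proper vertices H & F = cut H S].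

Definition minimal_edge_cut H F : Prop :=
  edge_cut H F /\ forall F', edge_cut H F' -> ~~ (F' \proper F).

(* A family is a finite set of trails, listed without repetition; finiteness is
   no restriction, as edge-disjoint closed trails each use at least two edges. *)
Definition Euler_family H (T : seq walk) : Prop :=
  [/\ uniq T,
      {in T, forall w, closed_trail H w},
      {in T &, forall w1 w2 : walk, w1 != w2 ->
        ~~ has (mem (traversed w1)) (traversed w2) /\
        ~~ has (mem (anchors w1)) (anchors w2)}
    & {in edges H, forall e, exists2 w : walk, w \in T & e \in traversed w}].

Definition spanning_Euler_family H (T : seq walk) : Prop :=
  Euler_family H T /\
  {in vertices H, forall v, exists2 w : walk, w \in T & v \in anchors w}.

Lemma subhypergraph_induced H A :
  A != set0 -> A \subset vertices H -> subhypergraph (induced H A) H.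
Proof.
move=> A0 AV; split=> //=.
- by split=> //= e _; exact: subsetIr.
- by apply/subsetP => e; rewrite inE => /andP[].
Qed.

Lemma is_hypergraph_delete_edges H F :
  is_hypergraph H -> is_hypergraph (delete_edges H F).
Proof. by case=> V0 HE; split=> // e /setDP[/HE]. Qed.

End Hypergraphs.

(* Main.v *)
(** By minimality of the cut, every edge of [F] meets every component of
    [H \ F].  Given an Euler family of [H], let [J] consist of the components
    that some trail enters through an edge of [F]; each edge of [F] is traversed
    once, so [#|J| <= #|F|].  The union [U] of these components cannot be left
    along a trail, and trails are closed, so each trail stays inside [U] or
    avoids [U], and in the latter case it uses no edge of [F] and stays inside
    one component.  Conversely, families of the pieces are simply put together. *)

Require Import Defs.
From mathcomp Require Import all_boot.

Set Implicit Arguments.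
Unset Strict Implicit.
Unset Printing Implicit Defensive.

(** * Walks, trails and vertex sets that they cannot leave *)

Section Walks.
Variables V E : finType.
Implicit Types (H K : prehypergraph V E) (A : {set V}) (p : seq (E * V)).

(** Only forward steps that occur in [p] are constrained, so the condition can be checked with facts
    about the trail at hand, such as the components it enters. *)
Definition steps_preserve H A p : Prop :=
  forall e x y, (e, y) \in p -> adjacent_via H e x y -> x \in A -> y \in A.

Lemma steps_preserve_behead H A s p :
  steps_preserve H A (s :: p) -> steps_preserve H A p.
Proof. by move=> hA e x y hp; apply: hA; rewrite inE hp orbT. Qed.

Lemma walk_from_preserve H A u p :
  steps_preserve H A p -> walk_from H u p -> u \in A ->
  {subset anchors (u, p) <= A}.
Proof.
rewrite /anchors /=.
elim: p u => [|[e v] p IHp] u hA /=; first by move=> _ uA x; rewrite inE => /eqP->.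
case/andP=> huv hp uA x; rewrite inE => /predU1P[-> //|].
apply: IHp => //; first exact: steps_preserve_behead hA.
by apply: hA huv uA; rewrite mem_head.
Qed.

Lemma wend_anchor (w : walk V E) : wend w \in anchors w.
Proof. exact: mem_last. Qed.

Lemma walk_from_preserve_wend H A u p x :
  steps_preserve H A p -> walk_from H u p -> x \in anchors (u, p) -> x \in A ->
  wend (u, p) \in A.
Proof.
elim: p u => [|[e v] p IHp] u hA hw; rewrite /anchors /=.
  by rewrite inE => /eqP->.
rewrite inE; case/predU1P=> [->|hx] xA.
- exact: walk_from_preserve hA hw xA _ (wend_anchor _).
- have /andP[_ hp] := hw.
  by apply: (IHp v) => //; apply: steps_preserve_behead hA.
Qed.

(** Forward preservation carries [A] from the anchor [x] to the end of the walk, which is also its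
    start, and from there over all anchors. *)
Lemma closed_walk_preserve H A (w : walk V E) x :
  steps_preserve H A w.2 -> is_walk H w -> closed_walk w ->
  x \in anchors w -> x \in A -> {subset anchors w <= A}.
Proof.
case: w => u p hA /andP[_ hw] /andP[/eqP hc _] hx xA.
apply: (walk_from_preserve hA hw); rewrite (hc : u = _).
exact: walk_from_preserve_wend hA hw hx xA.
Qed.

(** Serves in both directions: [A := vertices K] restricts a walk to a smaller [K], and [A := setT]
    views it in a larger hypergraph. *)
Lemma walk_from_transfer H K A (w : walk V E) :
  walk_from H w.1 w.2 -> {subset anchors w <= A} ->
  {in traversed w, forall e,
     e \in edges K /\ inc H e :&: A \subset inc K e} ->
  walk_from K w.1 w.2.
Proof.
case: w => u p /=; elim: p u => //= -[e v] p IHp u /andP[/and4P[eH uv ue ve] hp] hA hK.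
have [eK /subsetP sK] : e \in edges K /\ inc H e :&: A \subset inc K e.
  by apply: hK; rewrite mem_head.
apply/andP; split; last first.
  apply: IHp => //; first by move=> x hx; apply: hA; rewrite inE hx orbT.
  by move=> f hf; apply: hK; rewrite inE hf orbT.
rewrite /adjacent_via eK uv !sK // inE.
- by rewrite ve hA // !inE eqxx orbT.
- by rewrite ue hA // mem_head.
Qed.

Lemma traversed_edges H (w : walk V E) :
  is_walk H w -> {subset traversed w <= edges H}.
Proof.
case: w => u p /andP[_] /=; elim: p u => //= -[e v] p IHp u /andP[/and4P[eH _ _ _] hp] f.
by rewrite inE => /predU1P[->//|]; apply: IHp hp f.
Qed.

Lemma anchors_vertices H (w : walk V E) :
  is_hypergraph H -> is_walk H w -> {subset anchors w <= vertices H}.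
Proof.
case: w => u p [_ HE] /andP[/= uH hw].
apply: walk_from_preserve hw uH => e x y _ /and4P[eH _ _ ye] _.
exact: subsetP (HE e eH) y ye.
Qed.

Lemma closed_trailP H w :
  reflect [/\ is_walk H w, uniq (traversed w) & closed_walk w] (closed_trail H w).
Proof.
by apply: (iffP andP) => [[/andP[]]|[hw hu hc]]; split=> //; apply/andP.
Qed.

Lemma traversed_step H (w : walk V E) e :
  is_walk H w -> e \in traversed w ->
  exists y, [/\ (e, y) \in w.2, y \in anchors w, e \in edges H & y \in inc H e].
Proof.
case: w => u p /andP[_] /= hw /mapP[[f y] hp /= ->]; exists y.
have hy : y \in anchors (u, p).
  by rewrite inE; apply/orP; right; apply/mapP; exists (f, y).
suff: (f \in edges H) && (y \in inc H f) by case/andP.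
elim: p u hw hp {hy} => //= -[g v] p IHp u /andP[/and4P[gH _ _ vg] hw].
by rewrite inE => /predU1P[[-> ->]|/(IHp v hw)//]; rewrite gH.
Qed.

(** Within one trail, an edge of the cut can thus account for only one entered component, as the
    bound on [#|J|] requires. *)
Lemma trail_step_inj (w : walk V E) e y1 y2 :
  uniq (traversed w) -> (e, y1) \in w.2 -> (e, y2) \in w.2 -> y1 = y2.
Proof.
case: w => u p; rewrite /traversed /=; elim: p => //= -[f v] p IHp.
have nf y : (f, y) \in p -> f \in [seq x.1 | x <- p].
  by move=> hy; apply/mapP; exists (f, y).
case/andP=> /negP hf hu; rewrite !inE => /predU1P[[-> ->]|h1] /predU1P[[]|h2] //.
- by case: hf; apply: nf h2.
- by move=> ef _; case: hf; apply: (nf y1); rewrite -ef.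
- exact: IHp.
Qed.

End Walks.

(** * Connected components as reachability classes *)

Section Components.
Variables V E : finType.
Implicit Types (G K : prehypergraph V E) (S : {set V}) (F : {set E}).

Definition adjacent G : rel V := fun u v => [exists e, adjacent_via G e u v].

Definition reach G (v : V) : {set V} := [set u | connect (adjacent G) v u].

(** An edge that meets the class lies in it entirely, so [induced] truncates no edge here and only
    drops those missing the class. *)
Definition component_of G (v : V) : prehypergraph V E := induced G (reach G v).

Lemma adjacent_sym G : symmetric (adjacent G).
Proof.
move=> u v; apply: eq_existsb => e; rewrite /adjacent_via eq_sym.
by case: (e \in _); case: (v != u); rewrite //= andbC.
Qed.

Lemma connect_adjacent_sym G : connect_sym (adjacent G).
Proof. exact/sym_connect_sym/adjacent_sym. Qed.

Lemma edge_reach G e u v x :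
  e \in edges G -> u \in inc G e -> u \in reach G x -> v \in inc G e ->
  v \in reach G x.
Proof.
rewrite !inE => eG ue xu ve; have [<-//|uv] := eqVneq u v.
apply: connect_trans xu (connect1 _); apply/existsP; exists e.
by rewrite /adjacent_via eG uv ue ve.
Qed.

Lemma reach_vertices G v :
  is_hypergraph G -> v \in vertices G -> reach G v \subset vertices G.
Proof.
move=> [_ GE] vG; apply/subsetP => u; rewrite inE => /connectP[p].
elim: p v vG => [|x p IHp] v vG /=; first by move=> _ ->.
case/andP=> /existsP[e /and4P[eG _ _ xe]] hp hu; apply: IHp hp hu.
exact: subsetP (GE e eG) x xe.
Qed.

(** A path of adjacencies starting in the class never leaves it, and the trace of each edge used
    keeps both ends of the step. *)
Lemma hconnected_component_of G v : hconnected (component_of G v).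
Proof.
move=> x y /= xv yv.
have: connect (adjacent G) x y.
  by move: xv yv; rewrite !inE connect_adjacent_sym; apply: connect_trans.
case/connectP=> p; elim: p x xv => [|z p IHp] x xv /=.
  by move=> _ ->; exists (x, [::]); split=> //; rewrite /is_walk /= xv.
case/andP=> /existsP[e xz] hp hy; have /and4P[eG xnz xe ze] := xz.
have zv := edge_reach eG xe xv ze.
have [[u q] [/andP[/= _ hq] /= hu hend]] := IHp z zv hp hy; subst u.
exists (x, (e, z) :: q); split=> //.
rewrite /is_walk /= xv hq andbT /adjacent_via /= xnz !inE eG xe ze /=.
rewrite !inE in xv zv; rewrite xv zv !andbT.
by apply/set0Pn; exists x; rewrite !inE xe.
Qed.


(** Edges of [K] are traces of edges of [G], so no step of a walk in [K] leaves the class of [v]. *)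
Lemma hconnected_sub_reach G K v :
  subhypergraph K G -> hconnected K -> v \in vertices K ->
  vertices K \subset reach G v.
Proof.
move=> [_ _ /subsetP KG KI] cK vK; apply/subsetP => u uK.
have [[x p] [/andP[_ hp] /= hx <-]] := cK v u vK uK; subst x.
apply: (walk_from_preserve _ hp _ (wend_anchor _)); last by rewrite inE connect0.
move=> e x y _ /and4P[eK _]; rewrite KI // !inE => /andP[xe _] /andP[ye _].
by move=> xv; have:= edge_reach (KG e eK) xe _ ye => /(_ v); rewrite !inE; apply.
Qed.

Lemma subhypergraph_component_of G K v :
  subhypergraph K G -> hconnected K -> no_empty_edge K -> v \in vertices K ->
  subhypergraph K (component_of G v).
Proof.
move=> sK cK nK vK; have hsub := hconnected_sub_reach sK cK vK.
have [hK _ /subsetP KG KI] := sK; split=> //=.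
- apply/subsetP => e eK; rewrite inE KG //=.
  have /set0Pn[x] := nK e eK; rewrite KI // inE => /andP[xe xK].
  by apply/set0Pn; exists x; rewrite inE xe (subsetP hsub).
- by move=> e eK; rewrite KI // -setIA (setIidPr hsub).
Qed.

Lemma connected_component_of G v :
  is_hypergraph G -> v \in vertices G -> connected_component G (component_of G v).
Proof.
move=> hG vG.
have v0 : v \in reach G v by rewrite inE connect0.
split.
- by apply: subhypergraph_induced; [apply/set0Pn; exists v | apply: reach_vertices].
- exact: hconnected_component_of.
- by move=> e; rewrite inE => /andP[].
- move=> L sL cL nL [_ vL eL iL].
  have [_ vL' eL' iL'] :=
    subhypergraph_component_of sL cL nL (subsetP vL v v0).
  have eqV : vertices (component_of G v) = vertices L.
    by apply/eqP; rewrite eqEsubset vL vL'.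
  split=> //; first by apply/eqP; rewrite eqEsubset eL eL'.
  move=> e he; rewrite iL' ?(subsetP eL) // -eqV /=.
  by rewrite -setIA setIid.
Qed.

(** Connectedness puts [K] inside the component generated by [v]; maximality of [K] then forces
    equality. *)
Lemma connected_component_eq G K v :
  is_hypergraph G -> connected_component G K -> v \in vertices K ->
  same_hypergraph K (component_of G v).
Proof.
move=> hG [sK cK nK maxK] vK; have [_ /subsetP KG _ _] := sK.
have [s c n _] := connected_component_of hG (KG v vK).
by apply: maxK => //; apply: subhypergraph_component_of.
Qed.

Lemma cutPn G S e x y :
  is_hypergraph G -> e \in edges G -> e \notin cut G S -> x \in inc G e ->
  y \in inc G e -> x \in S -> y \in S.
Proof.
move=> [_ GE] eG; rewrite inE eG /= => eS xe ye xS; apply: contraNT eS => yS.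
apply/andP; split; apply/set0Pn; [exists x | exists y]; rewrite !inE.
- by rewrite xe.
- by rewrite ye yS (subsetP (GE e eG)).
Qed.

(** A walk from [u] that uses no edge of the cut never leaves [S], so it could not reach [v]. *)
Lemma hconnected_cut G K S u v :
  is_hypergraph G -> subhypergraph K G -> hconnected K ->
  u \in vertices K -> v \in vertices K -> u \in S -> v \notin S ->
  exists2 e, e \in edges K & e \in cut G S.
Proof.
move=> hG [_ _ /subsetP KG KI] cK uK vK uS vS.
apply/exists_inP; apply: contraNT vS; rewrite negb_exists_in => /forall_inP hS.
have [[x p] [/andP[_ hp] /= hx <-]] := cK u v uK vK; subst x.
apply: (walk_from_preserve _ hp uS (wend_anchor _)) => e x y _.
case/and4P=> eK _; rewrite KI // !inE => /andP[xe _] /andP[ye _].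
exact: cutPn (KG e eK) (hS e eK) xe ye.
Qed.

Lemma subhypergraph_refl G : is_hypergraph G -> subhypergraph G G.
Proof. by move=> hG; split=> // e /hG.2 /setIidPl. Qed.

Lemma edge_cut_neq0 G F :
  is_hypergraph G -> hconnected G -> edge_cut G F -> F != set0.
Proof.
move=> hG cG [S [/set0Pn[u uS] /properP[/subsetP SG [v vG vS]] ->]].
have [e _ eS] := hconnected_cut hG (subhypergraph_refl hG) cG (SG u uS) vG uS vS.
by apply/set0Pn; exists e.
Qed.

End Components.

(** * Components left after deleting a minimal edge cut *)

Section ComponentsOfCut.
Variables (V E I : finType) (H : prehypergraph V E) (F : {set E}).
Variable C : I -> prehypergraph V E.
Hypothesis H_hypergraph : is_hypergraph H.
Hypothesis H_no_empty_edge : no_empty_edge H.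
Hypothesis C_components : connected_components_of (delete_edges H F) C.

Let G := delete_edges H F.

Let hG : is_hypergraph G.
Proof. exact: is_hypergraph_delete_edges. Qed.

Lemma component_same i v :
  v \in vertices (C i) -> same_hypergraph (C i) (component_of G v).
Proof. by apply: connected_component_eq => //; case: C_components. Qed.

Lemma vertices_componentS i : vertices (C i) \subset vertices H.
Proof. by have [/(_ i)[[]]] := C_components. Qed.

Lemma component_neq0 i : vertices (C i) != set0.
Proof. by have [/(_ i)[[[]]]] := C_components. Qed.

Lemma component_exists v : v \in vertices H -> exists i, v \in vertices (C i).
Proof.
have [_ _ surj] := C_components => vH.
have [i [eqV _ _]] := surj _ (connected_component_of (G := G) hG vH).
by exists i; rewrite -eqV inE connect0.
Qed.

Lemma component_inj i j v :
  v \in vertices (C i) -> v \in vertices (C j) -> i = j.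
Proof.
have [_ inj _] := C_components.
move=> /component_same[vi ei ii] /component_same[vj ej ij]; apply: inj.
split; [by rewrite vi | by rewrite ei | move=> e he].
by rewrite ii // ij // ej -ei.
Qed.

(** An edge outside [F] survives the deletion, hence lies within the reachability class of any of
    its vertices. *)
Lemma component_edge i e v :
  e \in edges H -> e \notin F -> v \in inc H e -> v \in vertices (C i) ->
  [/\ e \in edges (C i), inc (C i) e = inc H e & inc H e \subset vertices (C i)].
Proof.
move=> eH eF ve /component_same[vi ei ii].
have eG : e \in edges G by rewrite inE eF.
have vv : v \in reach G v by rewrite inE connect0.
have eS : inc H e \subset reach G v.
  by apply/subsetP => u ue; apply: (edge_reach eG ve vv ue).
have eC : e \in edges (C i).
  by rewrite ei inE eG; apply/set0Pn; exists v; rewrite inE vv andbT.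
by split; rewrite ?ii ?vi //= (setIidPl eS).
Qed.

Lemma edges_component i e :
  e \in edges (C i) ->
  [/\ e \in edges H, e \notin F, inc (C i) e = inc H e
    & inc H e \subset vertices (C i)].
Proof.
have [/(_ i)[[_ _ /subsetP CG CI] _ nC _] _ _] := C_components => eC.
have /setDP[eH eF] := CG e eC.
have /set0Pn[v] := nC e eC; rewrite CI // inE => /andP[ve vC].
by have [_ eqI sub] := component_edge eH eF ve vC; split; rewrite // -CI.
Qed.

Lemma edge_component e :
  e \in edges H -> e \notin F -> exists i, e \in edges (C i).
Proof.
move=> eH eF; have /set0Pn[v ve] := H_no_empty_edge eH.
have [i vi] := component_exists (subsetP (H_hypergraph.2 e eH) v ve).
by exists i; have [] := component_edge eH eF ve vi.
Qed.

Hypothesis F_cut : minimal_edge_cut H F.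

Lemma cut_edges : F \subset edges H.
Proof.
by have [[S [_ _ ->]] _] := F_cut; apply/subsetP => e; rewrite inE => /andP[].
Qed.

(** A component containing all vertices would join the two sides of the cut and so use an edge of
    [F], but its edges avoid [F]. *)
Lemma component_proper i : vertices (C i) \proper vertices H.
Proof.
have [[S [/set0Pn[u uS] /properP[/subsetP SH [v vH vS]] defF]] _] := F_cut.
rewrite properE vertices_componentS; apply/negP => /subsetP HC.
have [/(_ i)[[hC _ _ CI] cC _ _] _ _] := C_components.
have sC : subhypergraph (C i) H.
  split=> //; first exact: vertices_componentS.
  by apply/subsetP => e /edges_component[].
have [e /edges_component[_ eF _ _]] :=
  hconnected_cut H_hypergraph sC cC (HC u (SH u uS)) (HC v vH) uS vS.
by rewrite -defF (negPf eF).
Qed.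

(* The edges leaving a component form an edge cut contained in [F]. *)
Lemma cut_component i : cut H (vertices (C i)) = F.
Proof.
(* Equality splits into an inclusion and the absence of a proper inclusion; the latter is the
   minimality of [F]. *)
apply/eqP; rewrite eqEproper.
have -> /= : cut H (vertices (C i)) \subset F.
  apply/subsetP => e; rewrite inE => /and3P[eH /set0Pn[x]].
  rewrite inE => /andP[xe xC] /set0Pn[y]; rewrite !inE => /and3P[ye yC _].
  apply: contraNT yC => eF; have [_ _ /subsetP] := component_edge eH eF xe xC.
  exact.
apply: F_cut.2; exists (vertices (C i)).
by rewrite component_neq0 component_proper.
Qed.

Lemma cut_meets_component i e :
  e \in F -> exists2 v, v \in inc H e & v \in vertices (C i).
Proof.
rewrite -(cut_component i) inE => /and3P[_ /set0Pn[v] + _].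
by rewrite inE => /andP[ve vC]; exists v.
Qed.

End ComponentsOfCut.

(** * Restricting and gluing Euler families *)

Section Families.
Variables V E : finType.
Implicit Types (H K : prehypergraph V E) (X : {set V}) (T : seq (walk V E)).

(* [X := set0] gives Euler families and [X := setT] spanning ones. *)
Definition covering_Euler_family X H T : Prop :=
  Euler_family H T /\
  {in vertices H :&: X, forall v, exists2 w : walk V E, w \in T & v \in anchors w}.

Lemma covering_set0 H T : covering_Euler_family set0 H T <-> Euler_family H T.
Proof. by split=> [[]//|hT]; split=> // v; rewrite setI0 inE. Qed.

Lemma covering_setT H T :
  covering_Euler_family setT H T <-> spanning_Euler_family H T.
Proof. by split=> -[hT hv]; split; rewrite // ?setIT // -[vertices H]setIT. Qed.

(** Trails are selected by their start; the first condition on trails makes this the same as having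
    some anchor in [K], which vertex covering needs. The other two conditions make the selected
    trails use only edges of [K] and traverse all of them. *)
Lemma covering_Euler_family_restrict X H K T :
  covering_Euler_family X H T ->
  vertices K \subset vertices H -> edges K \subset edges H ->
  (forall w x, w \in T -> x \in anchors w -> x \in vertices K ->
     {subset anchors w <= vertices K}) ->
  (forall w e, w \in T -> wstart w \in vertices K -> e \in traversed w ->
     e \in edges K /\ inc H e :&: vertices K \subset inc K e) ->
  (forall w e, w \in T -> e \in traversed w -> e \in edges K ->
     wstart w \in vertices K) ->
  covering_Euler_family X K [seq w <- T | wstart w \in vertices K].
Proof.
move=> [[uT cT dT eT] sT] /subsetP vKH /subsetP eKH hA hE hS; split; first split.
- exact: filter_uniq.
- move=> w; rewrite mem_filter => /andP[wK wT].
  have /closed_trailP[/andP[_ hw] hu hc] := cT w wT.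
  apply/closed_trailP; split=> //; rewrite /is_walk wK /=.
  apply: (walk_from_transfer (A := vertices K) hw) => [|e]; last exact: hE.
  by apply: (hA w (wstart w)) => //; apply: mem_head.
- move=> w1 w2; rewrite !mem_filter => /andP[_ w1T] /andP[_ w2T].
  exact: dT.
- move=> e eK; have [w wT we] := eT e (eKH e eK); exists w => //.
  by rewrite mem_filter wT (hS w e).
- move=> v /setIP[vK vX].
  have [|w wT vw] := sT v; first by rewrite inE vKH.
  by exists w; rewrite // mem_filter wT andbT (hA w v) // mem_head.
Qed.

(** The pieces partition vertices and edges, so trails from different pieces share neither; within
    one piece disjointness is given. *)
Lemma covering_Euler_family_glue (I : finType) X H
    (K : I -> prehypergraph V E) (T : I -> seq (walk V E)) :
  (forall i, is_hypergraph (K i)) ->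
  (forall i, vertices (K i) \subset vertices H) ->
  (forall i e, e \in edges (K i) -> e \in edges H /\ inc (K i) e \subset inc H e) ->
  (forall i j v, v \in vertices (K i) -> v \in vertices (K j) -> i = j) ->
  (forall i j e, e \in edges (K i) -> e \in edges (K j) -> i = j) ->
  {in edges H, forall e, exists i, e \in edges (K i)} ->
  {in vertices H, forall v, exists i, v \in vertices (K i)} ->
  (forall i, covering_Euler_family X (K i) (T i)) ->
  exists T', covering_Euler_family X H T'.
Proof.
move=> hK vKH eKH vK eK eH vH hT.
exists (undup (flatten [seq T i | i : I])).
have memT w : reflect (exists i, w \in T i) (w \in undup (flatten [seq T i | i : I])).
  rewrite mem_undup; apply: (iffP flatten_mapP) => [[i _ wi]|[i wi]]; exists i => //.
  exact: mem_enum.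
have trT i w : w \in T i -> closed_trail (K i) w by have [[_ + _ _] _] := hT i; apply.
split; first split.
- exact: undup_uniq.
- move=> w /memT[i /trT /closed_trailP[hw hu hc]]; apply/closed_trailP; split=> //.
  have trE := traversed_edges hw.
  have /andP[wK hf] := hw; rewrite /is_walk (subsetP (vKH i)) //=.
  apply: (walk_from_transfer (A := setT) hf) => [x _|e he]; first by rewrite inE.
  have [eH' /subsetP eS] := eKH i e (trE e he).
  by split=> //; apply/subsetP => x /setIP[/eS].
- move=> w1 w2 /memT[i w1i] /memT[j w2j] w12; have [ij|/eqP ij] := eqVneq i j.
    by subst j; have [[_ _ + _] _] := hT i; apply.
  have /closed_trailP[hw1 _ _] := trT i w1 w1i.
  have /closed_trailP[hw2 _ _] := trT j w2 w2j.
  split; apply/hasPn => x x2; apply/negP => x1; apply: ij.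
    exact: eK (traversed_edges hw1 x1) (traversed_edges hw2 x2).
  exact: vK (anchors_vertices (hK i) hw1 x1) (anchors_vertices (hK j) hw2 x2).
- move=> e /eH[i ei]; have [[_ _ _ /(_ e ei)[w wi we]] _] := hT i.
  by exists w => //; apply/memT; exists i.
- move=> v /setIP[/vH[i vi] vX]; have [_ /(_ v)[|w wi vw]] := hT i.
    by rewrite inE vi.
  by exists w => //; apply/memT; exists i.
Qed.

End Families.

(** * The equivalence for families covering a prescribed vertex set *)

Section Decomposition.
Variables (V E I : finType) (H : prehypergraph V E) (F : {set E}).
Variables (C : I -> prehypergraph V E) (X : {set V}).
Hypothesis H_hypergraph : is_hypergraph H.
Hypothesis H_no_empty_edge : no_empty_edge H.
Hypothesis H_connected : hconnected H.
Hypothesis F_cut : minimal_edge_cut H F.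
Hypothesis C_components : connected_components_of (delete_edges H F) C.

Let U (J : {set I}) := \bigcup_(j in J) vertices (C j).

Let F_neq0 : F != set0.
Proof. exact: edge_cut_neq0 F_cut.1. Qed.

Let UP (J : {set I}) v : reflect (exists2 j, j \in J & v \in vertices (C j)) (v \in U J).
Proof. exact: bigcupP. Qed.

Let U_sub J : U J \subset vertices H.
Proof. by apply/bigcupsP => j _; apply: (vertices_componentS C_components). Qed.

Lemma Euler_family_decompose T :
  covering_Euler_family X H T ->
  exists J : {set I},
    [/\ 1 <= #|J| <= #|F|,
        exists T', T' <> [::] /\ covering_Euler_family X (induced H (U J)) T'
      & forall i, i \notin J -> exists T', covering_Euler_family X (C i) T'].
Proof.
move=> hT; have [[uT cT dT eT] _] := hT.
(* In a step [(e, y)] the vertex [y] is where the trail arrives through [e]. Only arrivals count, so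
   an edge traversed once enters at most one component. *)
pose enters e i :=
  has (fun w : walk V E => has (fun s => (s.1 == e) && (s.2 \in vertices (C i))) w.2) T.
have entersP e i : reflect
    (exists w y, [/\ w \in T, (e, y) \in w.2 & y \in vertices (C i)]) (enters e i).
  apply: (iffP hasP) => [[w wT /hasP[[f y] hy /andP[/= /eqP <- yi]]]|].
    by exists w, y.
  case=> w [y [wT hy yi]]; exists w => //; apply/hasP; exists (e, y) => //.
  by rewrite /= eqxx.
pose J := [set i | [exists e in F, enters e i]]; exists J.
have walkT w : w \in T -> is_walk H w by move/cT/closed_trailP=> [].
have headU w e y : w \in T -> (e, y) \in w.2 -> e \in F -> y \in inc H e -> y \in U J.
  move=> wT hy eF ye; have eH := subsetP (cut_edges F_cut) e eF.
  have yH := subsetP (H_hypergraph.2 e eH) y ye.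
  have [j yj] := component_exists H_hypergraph C_components yH.
  apply/UP; exists j => //; rewrite inE; apply/exists_inP; exists e => //.
  by apply/entersP; exists w, y.
(* A step through [F] arrives in an entered component, and any other step stays in its component. *)
have trailU w x : w \in T -> x \in anchors w -> x \in U J -> {subset anchors w <= U J}.
  move=> wT; have /closed_trailP[hw _ hc] := cT w wT.
  apply: (closed_walk_preserve _ hw hc) => e y z hz /and4P[eH _ ye ze].
  have [eF _|eF] := boolP (e \in F); first exact: headU hz eF ze.
  case/UP=> j jJ yj; apply/UP; exists j => //.
  have [_ _ /subsetP] := component_edge H_hypergraph C_components eH eF ye yj.
  exact.
have cutU w e : w \in T -> e \in traversed w -> e \in F -> {subset anchors w <= U J}.
  move=> wT we eF; have [y [hy yw _ ye]] := traversed_step (walkT w wT) we.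
  by apply: (trailU w y) => //; apply: headU hy eF ye.
have [f fF] := set0Pn _ F_neq0.
have [w wT wf] := eT f (subsetP (cut_edges F_cut) f fF).
split.
- apply/andP; split.
    have /UP[j jJ _] := cutU w f wT wf fF _ (mem_head _ _).
    by apply/card_gt0P; exists j.
  (* Each [i] in [J] is the component picked for some edge of [F]. So [J], embedded by [Some], lies
     in the image of [F] under the [pick] map. *)
  rewrite -(card_imset _ (@Some_inj _)).
  apply: leq_trans (leq_imset_card (fun e => [pick i | enters e i]) F).
  apply/subset_leq_card/subsetP => _ /imsetP[i + ->].
  rewrite inE => /exists_inP[e eF ei]; apply/imsetP; exists e => //.
  case: pickP => [j|/(_ i)]; last by rewrite ei.
  move/entersP=> [w2 [y2 [w2T hy2 yj]]]; move/entersP: ei => [w1 [y1 [w1T hy1 yi]]].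
  (* Both steps traverse [e]: in one trail they coincide, and distinct trails are edge-disjoint. *)
  congr Some; have [eqw|w12] := eqVneq w1 w2.
    subst w2; have /closed_trailP[_ hu _] := cT w1 w1T.
    rewrite (trail_step_inj hu hy1 hy2) in yi.
    exact: component_inj H_hypergraph C_components _ _ _ yi yj.
  have [/hasPn/(_ e)+ _] := dT w1 w2 w1T w2T w12.
  have et (u : walk V E) y : (e, y) \in u.2 -> e \in traversed u by move=> h; apply/mapP; exists (e, y).
  by rewrite (et w2 y2) // => /(_ isT)/negP[]; apply: et hy1.
- exists [seq w <- T | wstart w \in U J]; split.
    (* The trail through [f], an edge of the non-empty cut, makes the selected family non-empty. *)
    have: w \in [seq w <- T | wstart w \in U J].
      by rewrite mem_filter wT andbT (cutU w f) // mem_head.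
    by case: [seq w <- T | _].
  apply: (covering_Euler_family_restrict hT) => //=.
  + by apply/subsetP => e; rewrite inE => /andP[].
  + move=> w' e w'T w'U we; have [y [hy yw eH ye]] := traversed_step (walkT w' w'T) we.
    split=> //; rewrite inE eH; apply/set0Pn; exists y; rewrite inE ye.
    exact: trailU w'T (mem_head _ _) w'U _ yw.
  + move=> w' e w'T we; rewrite inE => /andP[eH /set0Pn[x]].
    rewrite inE => /andP[xe xU].
    have [y [hy yw _ ye]] := traversed_step (walkT w' w'T) we.
    apply: (trailU w' y) => //; last exact: mem_head.
    (* An edge of [F] arrives in an entered component; any other edge lies wholly in the component
       of [x]. *)
    have [eF|eF] := boolP (e \in F); first exact: headU hy eF ye.
    have /UP[j jJ xj] := xU; apply/UP; exists j => //.
    have [_ _ /subsetP] := component_edge H_hypergraph C_components eH eF xe xj.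
    exact.
- move=> i iJ; exists [seq w <- T | wstart w \in vertices (C i)].
  (* A trail using an edge of [F] has all anchors in [U J], which is disjoint from [C i] as [i] is
     outside [J]. *)
  have noF u x e : u \in T -> x \in anchors u -> x \in vertices (C i) ->
      e \in traversed u -> e \notin F.
    move=> uT' xu xi eu; apply: contraNN iJ => eF.
    have /UP[j jJ xj] := cutU u e uT' eu eF x xu.
    by rewrite (component_inj H_hypergraph C_components xi xj).
  have trailC u x : u \in T -> x \in anchors u -> x \in vertices (C i) ->
      {subset anchors u <= vertices (C i)}.
    move=> uT' xu xi; have /closed_trailP[hu _ hc] := cT u uT'.
    apply: (closed_walk_preserve _ hu hc xu xi) => e y z hz /and4P[eH _ ye ze] yi.
    have eF : e \notin F by apply: (noF u x) => //; apply/mapP; exists (e, z).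
    have [_ _ /subsetP] := component_edge H_hypergraph C_components eH eF ye yi.
    exact.
  apply: (covering_Euler_family_restrict hT) => //.
  + exact: vertices_componentS C_components i.
  + by apply/subsetP => e /(edges_component H_hypergraph C_components)[].
  + move=> u e uT' ui eu; have [y [hy yu eH ye]] := traversed_step (walkT u uT') eu.
    have eF := noF u _ e uT' (mem_head _ _) ui eu.
    have yi := trailC u _ uT' (mem_head _ _) ui y yu.
    have [eC -> _] := component_edge H_hypergraph C_components eH eF ye yi.
    by split=> //; apply: subsetIl.
  + move=> u e uT' eu /(edges_component H_hypergraph C_components)[_ _ _ /subsetP eS].
    have [y [hy yu _ ye]] := traversed_step (walkT u uT') eu.
    exact: trailC uT' yu (eS y ye) _ (mem_head _ _).
Qed.

(** Every edge of [F] meets every component, so with [J] non-empty it meets [U J] and belongs to the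
    induced piece; with [J] empty it would lie in no piece. *)
Lemma Euler_family_compose (J : {set I}) T :
  0 < #|J| -> covering_Euler_family X (induced H (U J)) T ->
  (forall i, i \notin J -> exists T', covering_Euler_family X (C i) T') ->
  exists T', covering_Euler_family X H T'.
Proof.
move=> /card_gt0P[j0 j0J] hT hC.
have [TC hTC] := fin_all_exists (fun k : {i | i \notin J} => hC (val k) (valP k)).
(* The pieces are the components outside [J] and, at index [None], the part induced on [U J]. *)
pose K (k : option {i | i \notin J}) :=
  if k is Some i then C (val i) else induced H (U J).
have CU (k : {i | i \notin J}) v : v \in vertices (C (val k)) -> v \in U J -> False.
  move=> vk /UP[j jJ vj]; have := valP k.
  by rewrite (component_inj H_hypergraph C_components vk vj) jJ.
have CE (k : {i | i \notin J}) e :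
    e \in edges (C (val k)) -> e \in edges (induced H (U J)) -> False.
  case/(edges_component H_hypergraph C_components)=> _ _ _ /subsetP eS.
  by rewrite inE => /andP[_ /set0Pn[v /setIP[/eS vk vU]]]; apply: CU vk vU.
apply: (@covering_Euler_family_glue _ _ _ X H K (fun k => if k is Some i then TC i else T)).
- move=> [k|] /=.
    by have [/(_ (val k))[[]]] := C_components.
  split=> [|e _ /=]; last exact: subsetIr.
  have /set0Pn[v vj] := component_neq0 C_components j0.
  by apply/set0Pn; exists v; apply/UP; exists j0.
- by move=> [k|] //=; apply: (vertices_componentS C_components).
- move=> [k|] e /=; last by rewrite inE => /andP[eH _]; split=> //; apply: subsetIl.
  by case/(edges_component H_hypergraph C_components)=> eH _ -> _.
- move=> [k|] [l|] v //= vk vl.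
  + by congr Some; apply/val_inj/(component_inj H_hypergraph C_components vk vl).
  + by case: (CU k v).
  + by case: (CU l v).
- move=> [k|] [l|] e //= ek el.
  (* A shared edge is non-empty and contained in both components, so these share a vertex. *)
  + congr Some; apply: val_inj.
    have [eH _ _ /subsetP ekS] := edges_component H_hypergraph C_components ek.
    have [_ _ _ /subsetP elS] := edges_component H_hypergraph C_components el.
    have /set0Pn[v ve] := H_no_empty_edge eH.
    exact: component_inj H_hypergraph C_components _ _ _ (ekS v ve) (elS v ve).
  + by case: (CE k e).
  + by case: (CE l e).
- move=> e eH; have [eU|eU] := boolP (e \in edges (induced H (U J))).
    by exists None.
  (* An edge outside the induced piece misses [U J]; hence it is not in [F], and the component
     containing it has an index outside [J]. *)
  have disjU v j : v \in inc H e -> j \in J -> v \notin vertices (C j).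
    move=> ve jJ; apply: contraNN eU => vj; rewrite inE eH.
    by apply/set0Pn; exists v; rewrite inE ve; apply/UP; exists j.
  have eF : e \notin F.
    apply/negP => /(cut_meets_component H_hypergraph C_components F_cut j0)[v ve].
    exact/negP/disjU.
  have [i ei] := edge_component H_hypergraph H_no_empty_edge C_components eH eF.
  have [_ _ _ /subsetP eS] := edges_component H_hypergraph C_components ei.
  have /set0Pn[v ve] := H_no_empty_edge eH.
  have iJ : i \notin J by apply: contraTN (eS v ve); apply: disjU.
  by exists (Some (exist _ i iJ)).
- move=> v vH; have [i vi] := component_exists H_hypergraph C_components vH.
  have [iJ|iJ] := boolP (i \in J); last by exists (Some (exist _ i iJ)).
  by exists None; apply/UP; exists i.
- by case=> [k|] //; apply: hTC.
Qed.

Lemma covering_Euler_family_cut :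
  (exists T, covering_Euler_family X H T) <->
  exists J : {set I},
    [/\ 1 <= #|J| <= #|F|,
        exists T, T <> [::] /\ covering_Euler_family X (induced H (U J)) T
      & forall i, i \notin J -> exists T, covering_Euler_family X (C i) T].
Proof.
split=> [[T /Euler_family_decompose//]|[J [/andP[J0 _] [T [_ hT]] hC]]].
exact: Euler_family_compose hT hC.
Qed.

End Decomposition.

Theorem theorem5p2 (V E : finType) (H : prehypergraph V E) (F : {set E})
    (I : finType) (C : I -> prehypergraph V E)
    (H_hypergraph : is_hypergraph H)
    (H_no_empty_edge : no_empty_edge H)
    (H_connected : hconnected H)
    (F_cut : minimal_edge_cut H F)
    (C_components : connected_components_of (delete_edges H F) C) :
  ((exists T, Euler_family H T) <->
   exists J : {set I},
     [/\ 1 <= #|J| <= #|F|,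
         exists T, T <> [::] /\
           Euler_family (induced H (\bigcup_(j in J) vertices (C j))) T
       & forall i, i \notin J -> exists T, Euler_family (C i) T])
  /\
  ((exists T, spanning_Euler_family H T) <->
   exists J : {set I},
     [/\ 1 <= #|J| <= #|F|,
         exists T, T <> [::] /\
           spanning_Euler_family (induced H (\bigcup_(j in J) vertices (C j))) T
       & forall i, i \notin J -> exists T, spanning_Euler_family (C i) T]).
Proof.
have ex2 (P Q : seq (walk V E) -> Prop) :
    (forall T, P T <-> Q T) -> (exists T, P T) <-> (exists T, Q T).
  by move=> PQ; split=> -[T /PQ hT]; exists T.
have hcut X := covering_Euler_family_cut X H_hypergraph H_no_empty_edge H_connected
  F_cut C_components.
(* Both equivalences are instances of the covering version, read through a notion [Q] that agrees
   with covering for a fixed [X]. *)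
have key (Q : prehypergraph V E -> seq (walk V E) -> Prop) X :
    (forall K T, covering_Euler_family X K T <-> Q K T) ->
    (exists T, Q H T) <->
    exists J : {set I},
      [/\ 1 <= #|J| <= #|F|,
          exists T, T <> [::] /\ Q (induced H (\bigcup_(j in J) vertices (C j))) T
        & forall i, i \notin J -> exists T, Q (C i) T].
  move=> hQ; split.
    move/(ex2 _ _ (hQ H))/hcut=> [J [J1 [T [T0 hT]] hC]]; exists J; split=> //.
      by exists T; split=> //; apply/hQ.
    by move=> i /hC/(ex2 _ _ (hQ (C i))).
  move=> [J [J1 [T [T0 hT]] hC]]; apply/(ex2 _ _ (hQ H))/hcut; exists J; split=> //.
    by exists T; split=> //; apply/hQ.
  by move=> i /hC/(ex2 _ _ (hQ (C i))).
split; [exact: key (@covering_set0 V E) | exact: key (@covering_setT V E)].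
Qed.
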